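(* Fix $\kappa>1$. As $\alpha\downarrow\alpha_\star(\kappa)$ from above, $$e_\star(\alpha,\kappa)=\frac{(\alpha-\alpha_\star(\kappa))^2}{2\alpha_\star(\kappa)\,m(\omega_\kappa)^2}+o\big((\alpha-\alpha_\star(\kappa))^2\big).$$
   Context: Let $\nu$ be the probability measure on $[-\sqrt2,\sqrt2]$ with density $\frac1\pi\sqrt{2-x^2}$. Define $$\alpha_\star(\kappa)=\sup_{\substack{f\in L^2(\nu),\ f\ge0\\ \int f\,d\nu=1}}\frac{\left(\int x f(x)\,d\nu(x)\right)^2}{\int f(x)^2\,d\nu(x)+(\kappa-3)/2}.$$ For real $\omega$ let $s(\omega)=\int (x-\omega)_+^2\,d\nu(x)$, $m(\omega)=\int (x-\omega)_+\,d\nu(x)$ and $\mathcal E_\kappa(\omega)=s(\omega)+\frac{\kappa-3}{2}m(\omega)^2$. Let $\omega_\kappa$ be the unique solution of $\omega_\kappa=\frac{\kappa-3}{2}m(\omega_\kappa)$. For $\alpha>0$ let $\omega_{\alpha,\kappa}<\sqrt2$ be the unique solution of $\mathcal E_\kappa(\omega_{\alpha,\kappa})=\alpha$, and set $$e_\star(\alpha,\kappa)=\frac2\alpha\Big(\frac{\kappa-3}{2}m(\omega_{\alpha,\kappa})-\omega_{\alpha,\kappa}\Big)_+^2 .$$ *)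

(* Defs.v *)
From HB Require Import structures.
From mathcomp Require Import all_boot all_order all_algebra.
From mathcomp Require Import all_classical all_reals all_analysis.
From mathcomp Require Import measurable_realfun.

Set Implicit Arguments.
Unset Strict Implicit.
Unset Printing Implicit Defensive.

Import Order.TTheory GRing.Theory Num.Theory.
Import numFieldNormedType.Exports.

Local Open Scope classical_set_scope.
Local Open Scope ring_scope.

Section semicircle.
Context {R : realType}.
Local Notation mu := (@lebesgue_measure R).
Implicit Types (f : R -> R) (kappa alpha w x : R).

(* Zero outside [-sqrt 2, sqrt 2], since Num.sqrt vanishes on negatives. *)
Definition semicircle_pdf x : R := Num.sqrt (2 - x ^+ 2) / pi.

Lemma semicircle_pdf_ge0 x : 0 <= semicircle_pdf x.
Proof. by rewrite divr_ge0 ?sqrtr_ge0 ?pi_ge0. Qed.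

Lemma measurable_semicircle_pdf : measurable_fun setT semicircle_pdf.
Proof.
apply: measurable_funM; last exact: measurable_cst.
apply: continuous_measurable_fun => x.
apply: (@continuous_comp _ _ _ (fun x : R => 2 - x ^+ 2) Num.sqrt); last first.
  exact: sqrt_continuous.
by apply: cvgB; [exact: cvg_cst | exact: exprn_continuous].
Qed.

Definition nu (A : set (measurableTypeR R)) : \bar R :=
  (\int[mu]_(x in A) (semicircle_pdf x)%:E)%E.

Let nu0 : nu set0 = 0%E.
Proof. by rewrite /nu integral_set0. Qed.

Let nu_ge0 A : (0 <= nu A)%E.
Proof. by apply: integral_ge0 => x _; rewrite lee_fin semicircle_pdf_ge0. Qed.

Let nu_sigma_additive : semi_sigma_additive nu.
Proof.
move=> /= F mF tF mUF; rewrite /nu; apply: cvg_toP.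
  apply: ereal_nondecreasing_is_cvgn => m n mn.
  apply: lee_sum_nneg_natr => // k _ _.
  by apply: integral_ge0 => /= x Fkx; rewrite lee_fin semicircle_pdf_ge0.
rewrite ge0_integral_bigcup//=.
- apply: measurable_funTS; apply: measurableT_comp => //.
  exact: measurable_semicircle_pdf.
- by move=> x _; rewrite lee_fin semicircle_pdf_ge0.
Qed.

HB.instance Definition _ := isMeasure.Build _ _ _ nu
  nu0 nu_ge0 nu_sigma_additive.

Definition admissible f : Prop :=
  [/\ f \in Lfun nu 2%:E, {ae nu, forall x, 0 <= f x} & \int[nu]_x f x = 1].

Definition alpha_star kappa : R :=
  sup [set (\int[nu]_x (x * f x)) ^+ 2
             / (\int[nu]_x (f x ^+ 2) + (kappa - 3) / 2)
      | f in admissible].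

Definition pospart x : R := Num.max x 0.

Definition s_nu w : R := \int[nu]_x (pospart (x - w) ^+ 2).

Definition m_nu w : R := \int[nu]_x pospart (x - w).

Definition E_kappa kappa w : R := s_nu w + (kappa - 3) / 2 * m_nu w ^+ 2.

(* Definite description; the default value 0 is returned only when P does not
   have exactly one element. *)
Definition the_unique (P : set R) : R :=
  xget 0 [set w | P w /\ forall w', P w' -> w' = w].

Definition omega_kappa kappa : R :=
  the_unique [set w | w = (kappa - 3) / 2 * m_nu w].

Definition omega_alpha_kappa alpha kappa : R :=
  the_unique [set w | w < Num.sqrt 2 /\ E_kappa kappa w = alpha].

Definition e_star alpha kappa : R :=
  2 / alpha *
  pospart ((kappa - 3) / 2 * m_nu (omega_alpha_kappa alpha kappa)
             - omega_alpha_kappa alpha kappa) ^+ 2.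

End semicircle.

(* Main.v *)
Require Import Defs.
From HB Require Import structures.
From mathcomp Require Import all_boot all_order all_algebra.
From mathcomp Require Import all_classical all_reals all_analysis.
From mathcomp Require Import measurable_realfun ring lra.
Import Order.TTheory GRing.Theory Num.Theory.
Import numFieldNormedType.Exports.
Local Open Scope classical_set_scope.
Local Open Scope ring_scope.

(** Put c = (kappa - 3) / 2 > -1, so that E(w) = s(w) + c m(w) ^ 2, and
    h(w) = w - c m(w) (called [defect] below). Then omega_kappa is the zero
    of h, and the bracket in the definition of e_star is - h(omega_alpha).

    The supremum alpha_star equals E(omega_kappa) ([alpha_starE]). As [nu] has
    mass 1, the form <f, g> = int f g + c (int f) (int g) is positive on L^2(nu).
    For a density f and w = omega_kappa, the bound x <= (x - w)_+ + w and
    w = c m(w) give int x f <= <f, (x - w)_+>, and the Cauchy-Schwarz inequality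
    bounds the quotient by <(x - w)_+, (x - w)_+> = E(w), with equality at
    f = (x - w)_+ / m(w). If int x f < 0, the symmetry of [nu] reduces to the
    previous case.

    Formally E' = -2 m h', because s' = -2 m. Instead of differentiating, the
    increments are compared directly ([E_kappa_incr]): for v <= w,
    E(v) - E(w) = 2 m(w) (h(w) - h(v)) + r with 0 <= r <= (1 + |c|) (w - v) ^ 2,
    and h increases with a slope bounded below ([defect_incr]). This yields
    existence and uniqueness of omega_kappa and omega_alpha. With
    w = omega_kappa, v = omega_alpha, t = alpha - alpha_star and g = - h(v), it
    also reads t = 2 m(w) g + r with r = O(g ^ 2), so that g = t / (2 m(w)) +
    O(t ^ 2) and e_star = 2 g ^ 2 / alpha differs from
    t ^ 2 / (2 alpha_star m(w) ^ 2) by O(t ^ 3) ([e_star_cubic]). *)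

(** * The semicircle law *)

Section measure_nu.
Set Implicit Arguments.
Unset Strict Implicit.
Context {R : realType}.
Local Notation mu := (@lebesgue_measure R).
Local Notation r2 := (Num.sqrt 2 : R).

Lemma sqrt2_gt0 : 0 < r2.
Proof. by rewrite sqrtr_gt0. Qed.

Lemma sqr_sqrt2 : r2 ^+ 2 = 2.
Proof. by rewrite sqr_sqrtr. Qed.

Lemma semicircle_pdf_out x : x \notin `[- r2, r2] -> semicircle_pdf x = 0.
Proof.
move=> xI; rewrite /semicircle_pdf ler0_sqrtr ?mul0r//.
have [h|h] := leP 2 (x ^+ 2); first by rewrite subr_le0.
exfalso; move/negP: xI; apply; rewrite in_itv/= -ler_norml.
by rewrite -sqrtr_sqr ler_sqrt// ltW.
Qed.

Lemma semicircle_pdf_gt0 x : x \in `]- r2, r2[ -> 0 < semicircle_pdf x.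
Proof.
rewrite in_itv/= => /andP[xl xr]; rewrite /semicircle_pdf divr_gt0 ?pi_gt0//.
rewrite sqrtr_gt0 -sqr_sqrt2 subr_sqr mulr_gt0 ?subr_gt0//.
by rewrite addrC -ltrBlDr sub0r.
Qed.

Lemma continuous_semicircle_pdf : continuous (@semicircle_pdf R).
Proof.
move=> x; apply: cvgM; last exact: cvg_cst.
apply: (@continuous_comp _ _ _ (fun x : R => 2 - x ^+ 2) Num.sqrt); last first.
  exact: sqrt_continuous.
by apply: cvgB; [exact: cvg_cst | exact: exprn_continuous].
Qed.

(** The substitution x = sqrt 2 * sin t turns the density into
    (2 / pi) * cos t ^ 2, whose primitive is elementary. Total mass 1 is what
    makes Jensen's inequality available, hence the positivity of the quadratic
    form below for every constant down to -1. *)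
Lemma nu_setT : nu [set: measurableTypeR R] = 1%E.
Proof.
have r0 := sqrt2_gt0.
have pi0 := @pi_gt0 R.
have pilt : - (pi / 2) < pi / 2 :> R.
  by rewrite -subr_gt0 opprK addr_gt0// divr_gt0.
pose F x : R := r2 * sin x.
have dF x : is_derive x (1 : R) F (r2 * cos x).
  by rewrite /F; apply: is_derive_eq; rewrite ?scaler0 ?add0r.
have F'E : derive1 F = (fun x => r2 * cos x).
  by apply/funext => x; rewrite derive1E; exact: derive_val.
have cF' : continuous (fun x : R => r2 * cos x).
  by move=> x; apply: cvgM; [exact: cvg_cst|exact: continuous_cos].
have cF : continuous F.
  by move=> x; apply: cvgM; [exact: cvg_cst|exact: continuous_sin].
transitivity (\int[mu]_(x in `[F (- (pi / 2))%R, F (pi / 2)%R]) (semicircle_pdf x)%:E)%E.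
  rewrite /F sinN sin_pihalf mulrN mulr1 [RHS]integral_mkcond.
  apply: eq_integral => x _; rewrite patchE; case: ifPn => // xI.
  by rewrite semicircle_pdf_out//; apply: contra xI => /mem_set.
rewrite integration_by_substitution_increasing ?ltW//; last 6 first.
- by move=> x y xI yI xy; rewrite ltr_pM2l// ltr_sin.
- by rewrite F'E => x _; exact: cF'.
- by rewrite F'E; apply/cvg_ex; eexists; apply: cvg_at_right_filter; exact: cF'.
- by rewrite F'E; apply/cvg_ex; eexists; apply: cvg_at_left_filter; exact: cF'.
- split.
  + by move=> x _; case: (dF x).
  + by apply: cvg_at_right_filter; exact: cF.
  + by apply: cvg_at_left_filter; exact: cF.
- apply: continuous_subspaceT; exact: continuous_semicircle_pdf.
pose f x : R := (2 / pi) * cos x ^+ 2.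
pose G x : R := (x + sin x * cos x) / pi.
have dG x : is_derive x (1 : R) G (f x).
  rewrite /G; apply: is_derive_eq; rewrite /f /= ?scaler0 ?add0r.
  rewrite /GRing.scale/=; have := @cos2Dsin2 R x; move=> h.
  rewrite -[X in (X + _)]h.
  by move: (pi^-1) => p; ring.
have cG : continuous G.
  by move=> x; apply: differentiable_continuous; apply/derivable1_diffP; case: (dG x).
transitivity (\int[mu]_(x in `[(- (pi / 2))%R, (pi / 2)%R]) (f x)%:E)%E.
  apply: eq_integral => x; rewrite inE/= in_itv/= => xI.
  congr EFin; rewrite F'E /= !fctE /f /semicircle_pdf /F exprMn sqr_sqrt2.
  have -> : 2 - 2 * sin x ^+ 2 = 2 * cos x ^+ 2 :> R by rewrite cos2sin2; ring.
  rewrite sqrtrM// sqrtr_sqr ger0_norm ?cos_ge0_pihalf//.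
  transitivity (r2 ^+ 2 / pi * cos x ^+ 2); first by move: (pi^-1) r2 => p q; ring.
  by rewrite sqr_sqrt2.
rewrite (@continuous_FTC2 _ f G)//.
- rewrite /G sinN cosN cos_pihalf !mulr0 !addr0 -EFinB; congr EFin.
  by move: pi0; move: pi => p p0; field; rewrite gt_eqF.
- apply: continuous_subspaceT => x.
  by apply: cvgM; [exact: cvg_cst|apply: cvgM; exact: continuous_cos].
- split.
  + by move=> x _; case: (dG x).
  + by apply: cvg_at_right_filter; exact: cG.
  + by apply: cvg_at_left_filter; exact: cG.
- by move=> x _; rewrite derive1E; exact: derive_val.
Qed.

HB.instance Definition _ := Measure_isProbability.Build _ _ _ (@nu R) nu_setT.

Lemma nu_support : {ae (@nu R), forall x, x \in `[- r2, r2]}.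
Proof.
exists (~` [set` `[- r2, r2]]); split => //; first exact: measurableC.
change (\int[mu]_(x in ~` [set` `[(- r2)%R, r2%R]]) (semicircle_pdf x)%:E = 0)%E.
apply: integral0_eq => x /= xI.
by rewrite semicircle_pdf_out//; apply/negP.
Qed.

(** The symmetry of [nu] is what allows a density with a negative first moment
    to be traded for its mirror image in [alpha_starE]. *)
Lemma nuN (A : set (measurableTypeR R)) : measurable A ->
  pushforward (@nu R) (-%R : measurableTypeR R -> measurableTypeR R) A = nu A.
Proof.
move=> mA; rewrite /pushforward /nu.
transitivity (\int[pushforward mu (-%R : _ -> measurableTypeR R)]_(x in A)
    (semicircle_pdf x)%:E)%E; last first.
  by apply: eq_measure_integral => B mB BA; exact: lebesgue_measureN.
rewrite ge0_integral_pushforward//=.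
- by apply: eq_integral => x _; rewrite /semicircle_pdf sqrrN.
- by apply/measurable_EFinP/measurable_funTS; exact: measurable_semicircle_pdf.
- by move=> x _; rewrite lee_fin semicircle_pdf_ge0.
Qed.

(** A function bounded on the support is essentially bounded, and [nu] is
    finite, so that the inclusion of L^oo in L^2 applies. *)
Lemma bounded_Lfun_nu (f : R -> R) (M : R) : measurable_fun setT f ->
  (forall x, x \in `[- r2, r2] -> `|f x| <= M) -> f \in Lfun nu 2%:E.
Proof.
move=> mf fM.
apply: (@Lfun_subset _ _ _ nu 2%:E +oo%E).
- by rewrite lee_fin ler1n.
- by rewrite leey.
- exact: fin_num_measure.
- by rewrite leey.
rewrite inE; apply/andP; split; rewrite inE//= /finite_norm unlock/=.
case: ifP => _; last by rewrite ltry.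
apply: (@le_lt_trans _ _ M%:E); last by rewrite ltry.
apply/ess_sup_inf.ess_supP.
apply: (@filterS _ _ (ae_filter_ringOfSetsType (@nu R)) _ _ _ nu_support).
move=> x /fM.
by rewrite lee_fin.
Qed.

Lemma continuous_Lfun_nu (f : R -> R) : continuous f -> f \in Lfun nu 2%:E.
Proof.
move=> cf.
have /compact_bounded[M [_ hM]] : compact (f @` [set` `[- r2, r2]]).
  apply: continuous_compact; last exact: segment_compact.
  exact: continuous_subspaceT.
apply: (@bounded_Lfun_nu _ (M + 1)); first exact: continuous_measurable_fun.
move=> x xI; apply: (hM (M + 1)); first by rewrite ltrDl.
by exists x.
Qed.

Lemma Lfun2_integrable_nu {f : R -> R} : f \in Lfun nu 2%:E ->
  nu.-integrable setT (EFin \o f).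
Proof.
by move=> f2; apply/Lfun1_integrable; apply: Lfun_subset12 => //; exact: fin_num_measure.
Qed.

Lemma Lfun2_mul_integrable_nu {f g : R -> R} : f \in Lfun nu 2%:E ->
  g \in Lfun nu 2%:E -> nu.-integrable setT (EFin \o (fun x => f x * g x)).
Proof. by move=> f2 g2; apply/Lfun1_integrable; exact: Lfun2_mul_Lfun1. Qed.

Lemma Rintegral_nuN (f : R -> R) : continuous f ->
  \int[nu]_x f (- x) = \int[nu]_x f x.
Proof.
move=> cf.
have cfN : continuous (f \o -%R).
  by move=> x; apply: continuous_comp; [exact: opp_continuous|exact: cf].
rewrite /Rintegral; congr fine.
transitivity (\int[pushforward nu (-%R : measurableTypeR R -> measurableTypeR R)]_x
    (f x)%:E)%E; last first.
  by apply: eq_measure_integral => B mB _; exact: nuN.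
rewrite integral_pushforward//=.
- by apply/measurable_EFinP; exact: continuous_measurable_fun.
- exact: (Lfun2_integrable_nu (continuous_Lfun_nu cfN)).
Qed.

End measure_nu.

(** * A positive quadratic form on L^2(nu) *)

Section form.
Set Implicit Arguments.
Unset Strict Implicit.
Context {R : realType}.
Implicit Types (f g : R -> R) (c t : R).
Local Notation L2 := (Lfun (@nu R) 2%:E).
Local Notation integrable f := ((@nu R).-integrable setT (EFin \o f)).

Lemma integrable_nuZ f c : integrable f -> integrable (fun x => c * f x).
Proof.
move=> fi; have := @integrableZl _ _ _ (@nu R) _ measurableT c _ fi.
by congr ((@nu R).-integrable _ _); apply/funext => x.
Qed.

Lemma integrable_nuD f g : integrable f -> integrable g ->
  integrable (fun x => f x + g x).
Proof.
move=> fi gi; have := @integrableD _ _ _ (@nu R) _ measurableT _ _ fi gi.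
by congr ((@nu R).-integrable _ _); apply/funext => x.
Qed.

Lemma Rintegral_nu_lin f g c t : integrable f -> integrable g ->
  \int[nu]_x (c * f x + t * g x) = c * \int[nu]_x f x + t * \int[nu]_x g x.
Proof.
move=> fi gi; rewrite RintegralD//; last 2 first.
- exact: integrable_nuZ.
- exact: integrable_nuZ.
by rewrite !RintegralZl.
Qed.

Lemma Rintegral_nu_cst c : \int[nu]_x (cst c : R -> R) x = c.
Proof. by rewrite Rintegral_cst//= (@nu_setT R) mulr1. Qed.

Lemma Lfun2_sqr_integrable f : f \in L2 -> integrable (fun x => f x ^+ 2).
Proof. exact: Lfun2_integrable_sqr. Qed.

Lemma Lfun2_lin f g t : f \in L2 -> g \in L2 -> (fun x => f x + t * g x) \in L2.
Proof.
move=> f2 g2.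
have tg : (fun x => t * g x) \in L2.
  have -> : (fun x => t * g x) = t \o* g by apply/funext => x /=; rewrite mulrC.
  by apply: Lfun_scale; rewrite ?ler1n.
by have := rpredD f2 tg; apply; exact: lee1n.
Qed.

Lemma Rintegral_nu_sqrD f g t : f \in L2 -> g \in L2 ->
  \int[nu]_x ((f x + t * g x) ^+ 2) =
  \int[nu]_x (f x ^+ 2) + 2 * t * \int[nu]_x (f x * g x)
  + t ^+ 2 * \int[nu]_x (g x ^+ 2).
Proof.
move=> f2 g2.
have fi := Lfun2_sqr_integrable f2; have gi := Lfun2_sqr_integrable g2.
have fgi := Lfun2_mul_integrable_nu f2 g2.
transitivity (\int[nu]_x (1 * (1 * f x ^+ 2 + (2 * t) * (f x * g x))
    + t ^+ 2 * g x ^+ 2)).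
  by apply: eq_Rintegral => x _; ring.
rewrite Rintegral_nu_lin// ?Rintegral_nu_lin//; first by rewrite !mul1r.
by apply: integrable_nuD; exact: integrable_nuZ.
Qed.

(** The variance of f, i.e. the integral of (f - a) ^ 2 with a the mean of f,
    is nonnegative. *)
Lemma jensen_sqr f : f \in L2 -> (\int[nu]_x f x) ^+ 2 <= \int[nu]_x (f x ^+ 2).
Proof.
move=> f2; set a := \int[nu]_x f x.
have c2 : (cst 1 : R -> R) \in L2.
  by apply: continuous_Lfun_nu; exact: cst_continuous.
have : 0 <= \int[nu]_x ((f x + (- a) * (cst 1 : R -> R) x) ^+ 2).
  by apply: Rintegral_ge0 => x _; exact: sqr_ge0.
rewrite Rintegral_nu_sqrD//.
have -> : \int[nu]_x (f x * (cst 1 : R -> R) x) = a.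
  by apply: eq_Rintegral => x _; rewrite mulr1.
have -> : \int[nu]_x ((cst 1 : R -> R) x ^+ 2) = 1.
  by rewrite -[RHS]Rintegral_nu_cst; apply: eq_Rintegral => x _; rewrite expr1n.
by nra.
Qed.

(** The quadratic form whose value at a probability density is the denominator
    in [alpha_star]. *)
Lemma form_ge0 c f : -1 <= c -> f \in L2 ->
  0 <= \int[nu]_x (f x ^+ 2) + c * (\int[nu]_x f x) ^+ 2.
Proof. by move=> c1 /jensen_sqr; nra. Qed.

(** The form is nonnegative at f + t g; take for t the minimizer. *)
Lemma form_cauchy_schwarz c f g : -1 <= c -> f \in L2 -> g \in L2 ->
  0 < \int[nu]_x (g x ^+ 2) + c * (\int[nu]_x g x) ^+ 2 ->
  (\int[nu]_x (f x * g x) + c * (\int[nu]_x f x * \int[nu]_x g x)) ^+ 2 <=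
  (\int[nu]_x (f x ^+ 2) + c * (\int[nu]_x f x) ^+ 2) *
  (\int[nu]_x (g x ^+ 2) + c * (\int[nu]_x g x) ^+ 2).
Proof.
move=> c1 f2 g2 Qg.
set B := \int[nu]_x (f x * g x) + _; set Qf := \int[nu]_x (f x ^+ 2) + _.
set G := (X in _ * X).
pose t := - (B / G).
have := form_ge0 c1 (Lfun2_lin t f2 g2).
rewrite Rintegral_nu_sqrD//.
have -> : \int[nu]_x (f x + t * g x) = \int[nu]_x f x + t * \int[nu]_x g x.
  rewrite -[X in X + _]mul1r -Rintegral_nu_lin; last 2 first.
  - exact: Lfun2_integrable_nu.
  - exact: Lfun2_integrable_nu.
  by apply: eq_Rintegral => x _; rewrite mul1r.
move=> h.
have {h} : 0 <= Qf + 2 * t * B + t ^+ 2 * G.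
  by move: h; congr (_ <= _); rewrite /Qf /B /G; ring.
have -> : Qf + 2 * t * B + t ^+ 2 * G = (Qf * G - B ^+ 2) / G.
  by rewrite /t; field; rewrite gt_eqF.
by rewrite pmulr_lge0 ?invr_gt0// subr_ge0.
Qed.

End form.

(** * The truncated moments m and s *)

Lemma integral_gt0 d (T : measurableType d) (R : realType)
    (mu : {measure set T -> \bar R}) (D : set T) (f : T -> R) :
  measurable D -> measurable_fun D f -> (forall x, D x -> 0 < f x) ->
  (0 < mu D)%E -> (0 < \int[mu]_(x in D) (f x)%:E)%E.
Proof.
move=> mD mf f0 muD; rewrite lt_neqAle integral_ge0 ?andbT; last first.
  by move=> x /f0 fx; rewrite lee_fin ltW.
apply/eqP => /esym I0.
have : ae_eq mu D (EFin \o f) (cst 0%E).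
  apply/ae_eq_integral_abs => //; first exact/measurable_EFinP.
  rewrite -[RHS]I0; apply: eq_integral => x; rewrite inE => /f0 fx.
  by rewrite /= ger0_norm// ltW.
move=> f0D; have : mu.-negligible D.
  apply: negligibleS f0D => x Dx /= /(_ Dx) [] fx.
  by have := f0 _ Dx; rewrite fx ltxx.
by move/(measure_negligible mD) => D0; rewrite D0 ltxx in muD.
Qed.

Section moments.
Set Implicit Arguments.
Unset Strict Implicit.
Context {R : realType}.
Implicit Types w x : R.
Local Notation r2 := (Num.sqrt 2 : R).
Local Notation L2 := (Lfun (@nu R) 2%:E).

Lemma pospart_ge0 x : 0 <= pospart x.
Proof. by rewrite /pospart le_max lexx orbT. Qed.

Lemma pospart_ge x : x <= pospart x.
Proof. by rewrite /pospart le_max lexx. Qed.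

Lemma ger0_pospart x : 0 <= x -> pospart x = x.
Proof. by move=> x0; rewrite /pospart max_l. Qed.

Lemma ler0_pospart x : x <= 0 -> pospart x = 0.
Proof. by move=> x0; rewrite /pospart max_r. Qed.

Lemma continuous_pospart w : continuous (fun x => pospart (x - w)).
Proof.
move=> x; apply: (@continuous_max _ _ (fun x => x - w) (cst 0)).
- by apply: cvgB; [exact: cvg_id|exact: cvg_cst].
- exact: cvg_cst.
Qed.

Lemma pospart_Lfun w : (fun x => pospart (x - w)) \in L2.
Proof. by apply: continuous_Lfun_nu; exact: continuous_pospart. Qed.

(** The difference of the squares is 2 (w' - w) (x - w')_+ plus the square of
    the difference: to the right of w' the difference is exactly w' - w, to the
    left of it the cross term vanishes. *)
Lemma pospart_diff w w' x : w <= w' ->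
  0 <= pospart (x - w) - pospart (x - w') <= w' - w /\
  pospart (x - w) ^+ 2 = pospart (x - w') ^+ 2
    + 2 * (w' - w) * pospart (x - w')
    + (pospart (x - w) + -1 * pospart (x - w')) ^+ 2.
Proof.
move=> ww'; have [xw'|/ltW xw'] := leP w' x.
  rewrite !ger0_pospart; [|lra..].
  by split; [apply/andP; split; lra | ring].
rewrite [pospart (x - w')]ler0_pospart; last lra.
split; last by ring.
have [xw|/ltW xw] := leP w x.
  by rewrite ger0_pospart; [apply/andP; split; lra|lra].
by rewrite ler0_pospart; [apply/andP; split; lra|lra].
Qed.

Let posi w := Lfun2_integrable_nu (pospart_Lfun w).

Lemma m_nu_ge0 w : 0 <= m_nu w.
Proof. by apply: Rintegral_ge0 => x _; exact: pospart_ge0. Qed.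

(** [m_nu] is nonincreasing and 1-Lipschitz because [nu] is a probability. *)
Lemma m_nu_incr w w' : w <= w' -> 0 <= m_nu w - m_nu w' <= w' - w.
Proof.
move=> ww'; rewrite /m_nu -RintegralB//; try exact: posi.
apply/andP; split.
  by apply: Rintegral_ge0 => x _; have [/andP[]] := pospart_diff x ww'.
rewrite -[leRHS]Rintegral_nu_cst; apply: le_Rintegral => //.
- exact: (integrableB _ (posi _) (posi _)).
- apply: Lfun2_integrable_nu; apply: continuous_Lfun_nu; exact: cst_continuous.
- by move=> x _; have [/andP[]] := pospart_diff x ww'.
Qed.

(** A substitute for s' = -2m with a remainder bounded on both sides: the
    remainder is the integral of the square of D(x) = (x - w)_+ - (x - w')_+,
    bounded below by Jensen's inequality and above because 0 <= D <= w' - w. *)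
Lemma s_nu_incr w w' : w <= w' ->
  2 * (w' - w) * m_nu w' + (m_nu w - m_nu w') ^+ 2 <= s_nu w - s_nu w' <=
  2 * (w' - w) * m_nu w' + (w' - w) * (m_nu w - m_nu w').
Proof.
move=> ww'.
pose D x := pospart (x - w) + -1 * pospart (x - w').
have D2 : D \in L2 by apply: Lfun2_lin; exact: pospart_Lfun.
have ID : \int[nu]_x D x = m_nu w - m_nu w'.
  rewrite /m_nu -RintegralB//; try exact: posi.
  by apply: eq_Rintegral => x _; rewrite /D mulN1r.
have Es : s_nu w = s_nu w' + 2 * (w' - w) * m_nu w' + \int[nu]_x (D x ^+ 2).
  transitivity (\int[nu]_x (1 * (1 * pospart (x - w') ^+ 2
      + (2 * (w' - w)) * pospart (x - w')) + 1 * D x ^+ 2)).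
    by apply: eq_Rintegral => x _; have [_ ->] := pospart_diff x ww'; rewrite /D; ring.
  have si := Lfun2_sqr_integrable (pospart_Lfun w').
  rewrite Rintegral_nu_lin//; first by rewrite Rintegral_nu_lin// !mul1r.
    by apply: integrable_nuD; exact: integrable_nuZ.
  exact: Lfun2_sqr_integrable.
have lo := jensen_sqr D2; rewrite ID in lo.
have up : \int[nu]_x (D x ^+ 2) <= (w' - w) * (m_nu w - m_nu w').
  have Di := Lfun2_integrable_nu D2.
  rewrite -ID -RintegralZl//; apply: le_Rintegral => //.
  - exact: Lfun2_sqr_integrable.
  - exact: integrable_nuZ.
  - move=> x _; have [+ _] := pospart_diff x ww'.
    by rewrite /D mulN1r; move=> /andP[a b]; rewrite expr2 ler_wpM2r.
by rewrite Es; apply/andP; split; lra.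
Qed.

Lemma eq_Rintegral_nu (f g : R -> R) : continuous f -> continuous g ->
  (forall x, x \in `[- r2, r2] -> f x = g x) ->
  \int[nu]_x f x = \int[nu]_x g x.
Proof.
move=> cf cg fg; rewrite /Rintegral; congr fine; apply: ae_eq_integral => //.
- by apply/measurable_EFinP; exact: continuous_measurable_fun.
- by apply/measurable_EFinP; exact: continuous_measurable_fun.
- apply: (@filterS _ _ (ae_filter_ringOfSetsType (@nu R)) _ _ _
    (nu_support (R := R))).
  by move=> x /fg ->.
Qed.

Lemma m_nu_sqrt2 : m_nu r2 = 0.
Proof.
rewrite -[RHS]Rintegral_nu_cst; apply: eq_Rintegral_nu.
- exact: continuous_pospart.
- exact: cst_continuous.
- by move=> x; rewrite in_itv/= => /andP[_ xr]; rewrite ler0_pospart ?subr_le0.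
Qed.

Lemma s_nu_sqrt2 : s_nu r2 = 0.
Proof.
rewrite -[RHS]Rintegral_nu_cst; apply: eq_Rintegral_nu.
- move=> x; apply: (@continuous_comp _ _ _ (fun x => pospart (x - r2)) (fun x => x ^+ 2)).
    exact: continuous_pospart.
  exact: exprn_continuous.
- exact: cst_continuous.
- by move=> x; rewrite in_itv/= => /andP[_ xr]; rewrite ler0_pospart ?subr_le0// expr0n.
Qed.

Lemma nu_itv_gt0 (a b : R) : a < b -> - r2 <= a -> b <= r2 ->
  (0 < @nu R [set` `]a, b[])%E.
Proof.
move=> ab ra br; apply: integral_gt0 => //.
- by apply: measurable_funTS; exact: measurable_semicircle_pdf.
- move=> x /=; rewrite in_itv/= => /andP[ax xb]; apply: semicircle_pdf_gt0.
  by rewrite in_itv/= (le_lt_trans ra)// (lt_le_trans xb).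
- have := lebesgue_measure_itv `]a, b[; rewrite /= => ->.
  by rewrite lte_fin ab -EFinB lte_fin subr_gt0.
Qed.

Lemma m_nu_gt0 w : w < r2 -> 0 < m_nu w.
Proof.
move=> wr; pose a := Num.max w (- r2).
have [wa ra] : w <= a /\ - r2 <= a by rewrite /a !le_max !lexx orbT.
have ar : a < r2.
  by rewrite /a gt_max wr/= -subr_gt0 opprK addr_gt0// sqrt2_gt0.
have mp (D : set R) : measurable_fun D (fun x => pospart (x - w)).
  apply: measurable_funTS; apply: continuous_measurable_fun; exact: continuous_pospart.
rewrite -lte_fin /m_nu /Rintegral fineK; last first.
  by have := integrable_fin_num measurableT (posi w).
apply: (@lt_le_trans _ _ (\int[nu]_(x in [set` `]a, r2[]) (pospart (x - w))%:E)%E).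
  apply: integral_gt0 => //; [exact: mp| |exact: nu_itv_gt0].
  move=> x /=; rewrite in_itv/= => /andP[ax _].
  by rewrite ger0_pospart ?subr_gt0 ?subr_ge0 ?(le_lt_trans wa)// ltW// (le_lt_trans wa).
apply: ge0_subset_integral => //; first by apply/measurable_EFinP; exact: mp.
by move=> x _; rewrite lee_fin pospart_ge0.
Qed.

End moments.

(** * Definite descriptions and continuity *)

Section real_analysis.
Set Implicit Arguments.
Unset Strict Implicit.
Context {R : realType}.
Implicit Types (f : R -> R) (P : set R) (w x y : R).

Lemma the_unique_eq P w : P w -> (forall w', P w' -> w' = w) -> the_unique P = w.
Proof.
by move=> Pw uw; apply: xget_unique => [//|w' [/uw]].
Qed.

Lemma loc_lipschitz_continuous f (K : R -> R) :
  (forall y x, `|x - y| <= 1 -> `|f x - f y| <= K y * `|x - y|) -> continuous f.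
Proof.
move=> fK y; apply/cvgrPdist_le => /= e e0.
have K0 : 0 < `|K y| + 1 by rewrite ltr_wpDl.
near=> x.
rewrite distrC; apply: le_trans (fK _ _ _) _.
  by near: x; apply: cvgr_distC_le => //; exact: cvg_id.
apply: (@le_trans _ _ ((`|K y| + 1) * `|x - y|)).
  by rewrite ler_wpM2r// (le_trans (ler_norm _))// lerDl.
rewrite mulrC -ler_pdivlMr//; near: x.
by apply: cvgr_distC_le; [exact: cvg_id|rewrite divr_gt0].
Unshelve. all: by end_near. Qed.

End real_analysis.

(** * The variational formula for alpha_star *)

Section variational.
Set Implicit Arguments.
Unset Strict Implicit.
Context {R : realType}.
Implicit Types (f y P : R -> R) (c w x : R).
Local Notation L2 := (Lfun (@nu R) 2%:E).
Local Notation integrable f := ((@nu R).-integrable setT (EFin \o f)).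

Lemma ae_Rintegral_ge0 f : integrable f ->
  {ae (@nu R), forall x, 0 <= f x} -> 0 <= \int[nu]_x f x.
Proof.
move=> fi f0; rewrite (_ : \int[nu]_x f x = \int[nu]_x `|f x|).
  by apply: Rintegral_ge0 => x _; exact: normr_ge0.
have mf := measurable_int _ fi.
rewrite /Rintegral; congr fine; apply: ae_eq_integral => //.
  apply/measurable_EFinP; apply: measurableT_comp; first exact: normr_measurable.
  exact/measurable_EFinP.
apply: (@filterS _ _ (ae_filter_ringOfSetsType (@nu R)) _ _ _ f0) => x fx _ /=.
by rewrite ger0_norm.
Qed.

(** The upper bound on the functional defining [alpha_star]. Since f is a
    density, replacing y - w by the larger P bounds the integral of y f by that
    of P f, plus w; and w = c m(w) makes this sum the value at (f, P) of the
    bilinear form behind [form_cauchy_schwarz]. The test function y is x or -x,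
    according to the sign of the first moment of f. *)
Lemma Rintegral_mul_le_form y P f c w : -1 <= c -> w = c * m_nu w ->
  y \in L2 -> P \in L2 -> f \in L2 -> {ae (@nu R), forall x, 0 <= f x} ->
  \int[nu]_x f x = 1 -> (forall x, y x - w <= P x) ->
  \int[nu]_x P x = m_nu w -> \int[nu]_x (P x ^+ 2) = s_nu w ->
  0 < s_nu w + c * m_nu w ^+ 2 -> 0 <= \int[nu]_x (y x * f x) ->
  (\int[nu]_x (y x * f x)) ^+ 2 <=
  (\int[nu]_x (f x ^+ 2) + c) * (s_nu w + c * m_nu w ^+ 2).
Proof.
move=> c1 wE y2 P2 f2 f0 If yP IP IP2 E0 y0.
have := @form_cauchy_schwarz _ c f P c1 f2 P2.
rewrite IP IP2 If expr1n mulr1 mul1r => /(_ E0); apply: le_trans.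
suff : \int[nu]_x (y x * f x) <= \int[nu]_x (f x * P x) + c * m_nu w.
  by move: y0; set a := \int[nu]_x (y x * f x); set b := _ + _; nra.
have fi := Lfun2_integrable_nu f2.
have yfi := Lfun2_mul_integrable_nu y2 f2.
have fPi := Lfun2_mul_integrable_nu f2 P2.
rewrite -wE.
have : 0 <= \int[nu]_x (1 * (1 * (f x * P x) + (-1) * (y x * f x)) + w * f x).
  apply: ae_Rintegral_ge0.
    apply: integrable_nuD; last exact: integrable_nuZ.
    by apply: integrable_nuZ; apply: integrable_nuD; exact: integrable_nuZ.
  apply: (@filterS _ _ (ae_filter_ringOfSetsType (@nu R)) _ _ _ f0) => x fx.
  have := yP x; nra.
rewrite Rintegral_nu_lin//; last first.
  by apply: integrable_nuD; exact: integrable_nuZ.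
by rewrite Rintegral_nu_lin// If; lra.
Qed.

Lemma s_nu_ge w : m_nu w ^+ 2 <= s_nu w.
Proof. exact: (jensen_sqr (pospart_Lfun w)). Qed.

Lemma s_nu_form_gt0 c w : -1 < c -> 0 < m_nu w -> 0 < s_nu w + c * m_nu w ^+ 2.
Proof.
move=> c1 m0; have := s_nu_ge w.
have : 0 < (1 + c) * m_nu w ^+ 2 by rewrite mulr_gt0 ?exprn_gt0//; lra.
by lra.
Qed.

Lemma id_Lfun : (fun x : R => x) \in L2.
Proof. by apply: continuous_Lfun_nu => x; exact: cvg_id. Qed.

(** The supremum is attained at f(x) = (x - w)_+ / m(w), the equality case of
    the Cauchy-Schwarz argument. *)
Lemma alpha_starE kappa w : 1 < kappa -> w = (kappa - 3) / 2 * m_nu w ->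
  0 < m_nu w -> alpha_star kappa = E_kappa kappa w.
Proof.
rewrite /alpha_star /E_kappa; set c := (kappa - 3) / 2 => k1 wE m0.
have c1 : -1 < c by rewrite /c; lra.
have E0 := s_nu_form_gt0 c1 m0.
set A := [set _ | _ in _].
have ubA : ubound A (s_nu w + c * m_nu w ^+ 2).
  move=> _ [f [f2 f0 If] <-].
  have Q0 : 0 < \int[nu]_x (f x ^+ 2) + c.
    by have := jensen_sqr f2; rewrite If expr1n; lra.
  rewrite ler_pdivrMr// mulrC.
  have [xf|xf] := leP 0 (\int[nu]_x (x * f x)).
    apply: (@Rintegral_mul_le_form (fun x => x) (fun x => pospart (x - w))) => //.
    - exact: ltW.
    - exact: id_Lfun.
    - exact: pospart_Lfun.
    - by move=> x; exact: pospart_ge.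
  have NE : \int[nu]_x (- x * f x) = - \int[nu]_x (x * f x).
    have xfi := Lfun2_mul_integrable_nu id_Lfun f2.
    rewrite -mulN1r -RintegralZl//.
    by apply: eq_Rintegral => x _; rewrite mulN1r mulNr.
  rewrite -sqrrN -NE.
  have cN : continuous (fun x : R => - x) by move=> x; exact: opp_continuous.
  have cP := @continuous_pospart R w.
  have cPN : continuous (fun x => pospart (- x - w)).
    move=> x; apply: (@continuous_comp _ _ _ -%R (fun x => pospart (x - w))).
      exact: cN.
    exact: cP.
  apply: (@Rintegral_mul_le_form (fun x => - x) (fun x => pospart (- x - w))) => //.
  - exact: ltW.
  - exact: continuous_Lfun_nu.
  - exact: continuous_Lfun_nu.
  - by move=> x; exact: pospart_ge.
  - exact: (Rintegral_nuN cP).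
  - apply: (@Rintegral_nuN _ (fun x => pospart (x - w) ^+ 2)) => x.
    apply: (@continuous_comp _ _ _ (fun x => pospart (x - w)) (fun x => x ^+ 2)).
      exact: cP.
    exact: exprn_continuous.
  - by rewrite NE oppr_ge0 ltW.
have AE : A (s_nu w + c * m_nu w ^+ 2).
  have P2 := pospart_Lfun w.
  have Pi := Lfun2_integrable_nu P2.
  have PPi := Lfun2_sqr_integrable P2.
  have m_neq0 : m_nu w != 0 by rewrite gt_eqF.
  exists (fun x => (m_nu w)^-1 * pospart (x - w)).
    split.
    - have -> : (fun x => (m_nu w)^-1 * pospart (x - w)) =
          (m_nu w)^-1 \o* (fun x => pospart (x - w)).
        by apply/funext => x /=; rewrite mulrC.
      by apply: Lfun_scale; rewrite ?ler1n.
    - by apply: nearW => x; rewrite mulr_ge0 ?invr_ge0 ?pospart_ge0 ?ltW.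
    - by rewrite RintegralZl// mulVf.
  have -> : \int[nu]_x (x * ((m_nu w)^-1 * pospart (x - w))) =
      (s_nu w + c * m_nu w ^+ 2) / m_nu w.
    (* Because x (x - w)_+ = (x - w)_+ ^ 2 + w (x - w)_+. *)
    transitivity (\int[nu]_x ((m_nu w)^-1 * pospart (x - w) ^+ 2
        + (w / m_nu w) * pospart (x - w))).
      apply: eq_Rintegral => x _; have [xw|/ltW xw] := leP w x.
        by rewrite ger0_pospart ?subr_ge0//; ring.
      by rewrite ler0_pospart ?subr_le0//; ring.
    rewrite Rintegral_nu_lin// -/(s_nu w) -/(m_nu w) mulfVK// [X in _ + X]wE.
    by field.
  have -> : \int[nu]_x (((m_nu w)^-1 * pospart (x - w)) ^+ 2) = s_nu w / m_nu w ^+ 2.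
    transitivity (\int[nu]_x ((m_nu w)^- 2 * pospart (x - w) ^+ 2)).
      by apply: eq_Rintegral => x _; rewrite exprMn exprVn.
    by rewrite RintegralZl// mulrC.
  have -> : s_nu w / m_nu w ^+ 2 + c = (s_nu w + c * m_nu w ^+ 2) / m_nu w ^+ 2.
    by field.
  by field; rewrite m_neq0 gt_eqF.
apply/eqP; rewrite eq_le; apply/andP; split.
- by apply: ge_sup => //; eexists; exact: AE.
- by apply: ub_le_sup => //; eexists; exact: ubA.
Qed.

End variational.

(** * Increments of E and the asymptotics of e_star *)

Section increments.
Set Implicit Arguments.
Unset Strict Implicit.
Context {R : realType} (kappa : R).
Hypothesis kappa_gt1 : 1 < kappa.
Implicit Types w : R.
Local Notation r2 := (Num.sqrt 2 : R).
Local Notation c := ((kappa - 3) / 2).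
Local Notation E := (E_kappa kappa).

(** It vanishes at [omega_kappa], and the bracket in [e_star] is its opposite
    at [omega_alpha_kappa]. *)
Definition defect w := w - c * m_nu w.
Local Notation h := defect.

(** A lower bound for the difference quotients of [defect]. *)
Definition defect_slope : R := Num.min 1 (1 + c).
Local Notation slope := defect_slope.

Let c_gtN1 : - 1 < c.
Proof. have k1 := kappa_gt1; lra. Qed.

Lemma defect_slope_gt0 : 0 < slope.
Proof. by rewrite lt_min ltr01/= addrC -ltrBlDr sub0r. Qed.

(** The increment is (w' - w) + c D with 0 <= D <= w' - w; for c < 0 the second
    term costs at most the fraction |c| < 1 of the first. *)
Lemma defect_incr w w' : w <= w' ->
  slope * (w' - w) <= h w' - h w <= (1 + `|c|) * (w' - w).
Proof.
move=> ww'; have /andP[D0 Dd] := m_nu_incr ww'.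
have -> : h w' - h w = (w' - w) + c * (m_nu w - m_nu w') by rewrite /defect; ring.
have d0 : 0 <= w' - w by rewrite subr_ge0.
have [sl1 slc] : slope <= 1 /\ slope <= 1 + c by rewrite !ge_min !lexx orbT.
apply/andP; split.
  have [c0|/ltW c0] := leP 0 c.
    have := mulr_ge0 c0 D0; have := ler_wpM2r d0 sl1; lra.
  have := ler_wnM2l c0 Dd; have := ler_wpM2r d0 slc; lra.
have := ler_wpM2r D0 (ler_norm c).
have := ler_wpM2l (normr_ge0 c) Dd; lra.
Qed.

(** To first order, an increment of [E_kappa] is 2 m times the increment of
    [defect]. With d = w' - w and D = m(w) - m(w'), the error is the remainder
    of [s_nu_incr] plus c D ^ 2; the former is at least D ^ 2, so c > -1 keeps
    the sum nonnegative. *)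
Lemma E_kappa_incr w w' : w <= w' ->
  2 * m_nu w' * (h w' - h w) <= E w - E w' <=
  2 * m_nu w' * (h w' - h w) + (1 + `|c|) * (w' - w) ^+ 2.
Proof.
move=> ww'; have /andP[D0 Dd] := m_nu_incr ww'; have /andP[lo up] := s_nu_incr ww'.
set D := m_nu w - m_nu w' in D0 Dd lo up.
have hE : h w' - h w = (w' - w) + c * D by rewrite /defect /D; ring.
have -> : E w - E w' = s_nu w - s_nu w' + c * D * (2 * m_nu w' + D).
  by rewrite /E_kappa /D; ring.
have DD : D ^+ 2 <= (w' - w) ^+ 2 by rewrite ler_sqr ?nnegrE// (le_trans D0).
have dD : (w' - w) * D <= (w' - w) ^+ 2 by rewrite expr2 ler_wpM2l// subr_ge0.
have c1 : 0 <= (1 + c) * D ^+ 2.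
  by rewrite mulr_ge0 ?sqr_ge0//; have := c_gtN1; lra.
have c2 : c * D ^+ 2 <= `|c| * (w' - w) ^+ 2.
  apply: (le_trans (ler_wpM2r (sqr_ge0 D) (ler_norm c))).
  by rewrite ler_wpM2l.
by rewrite hE; apply/andP; split; lra.
Qed.

Lemma continuous_defect : continuous h.
Proof.
apply: (@loc_lipschitz_continuous _ _ (fun=> 1 + `|c|)) => y x _.
wlog xy : x y / x <= y.
  move=> wl; have [|/ltW] := leP x y; first exact: wl.
  by rewrite distrC [X in _ <= _ * X]distrC; exact: wl.
have /andP[lo up] := defect_incr xy.
have lo0 : 0 <= h y - h x.
  by apply: le_trans lo; rewrite mulr_ge0 ?subr_ge0// ltW// defect_slope_gt0.
rewrite distrC [X in _ <= _ * X]distrC ger0_norm//.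
by rewrite [X in _ <= _ * X]ger0_norm ?subr_ge0.
Qed.

Lemma continuous_E_kappa : continuous E.
Proof.
(* Within distance 1 of y, m is at most m(y - 1), as it is nonincreasing. *)
apply: (@loc_lipschitz_continuous _ _
  (fun y => (1 + `|c|) * (2 * m_nu (y - 1) + 1))) => y x xy1.
have key w w' : w <= w' -> w' - w <= 1 -> y - 1 <= w' ->
    `|E w - E w'| <= (1 + `|c|) * (2 * m_nu (y - 1) + 1) * (w' - w).
  move=> ww' d1 yw'; have /andP[lo up] := E_kappa_incr ww'.
  have /andP[hlo hup] := defect_incr ww'.
  have d0 : 0 <= w' - w by rewrite subr_ge0.
  have h0 : 0 <= h w' - h w.
    by apply: le_trans hlo; rewrite mulr_ge0// ltW// defect_slope_gt0.
  have m0 := m_nu_ge0 w'.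
  have mm : m_nu w' <= m_nu (y - 1).
    by have /andP[+ _] := m_nu_incr yw'; rewrite subr_ge0.
  have E0 : 0 <= E w - E w' by apply: le_trans lo; rewrite !mulr_ge0.
  rewrite ger0_norm//; apply: (le_trans up).
  set k := 1 + `|c|; have k0 : 0 <= k by rewrite addr_ge0.
  have a1 : 2 * m_nu w' * (h w' - h w) <= 2 * m_nu (y - 1) * (k * (w' - w)).
    by apply: ler_pM => //; [rewrite mulr_ge0|rewrite ler_pM2l].
  have a2 : k * (w' - w) ^+ 2 <= k * (w' - w).
    by rewrite ler_wpM2l// expr2 ler_piMr.
  lra.
move: xy1; have [xy|/ltW yx] := leP x y => xy1.
  rewrite [X in _ <= _ * X]distrC [X in _ <= _ * X]ger0_norm ?subr_ge0//.
  rewrite distrC ger0_norm ?subr_ge0// in xy1.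
  by apply: key => //; rewrite gerBl.
rewrite distrC [X in _ <= _ * X]ger0_norm ?subr_ge0//.
rewrite ger0_norm ?subr_ge0// in xy1.
by apply: key => //; rewrite (le_trans _ yx)// gerBl.
Qed.

Lemma omega_kappa_def :
  omega_kappa kappa = c * m_nu (omega_kappa kappa) /\ omega_kappa kappa < r2.
Proof.
have sl := defect_slope_gt0.
pose b := `|h 0| / slope.
have b0 : 0 <= b by rewrite divr_ge0// ltW.
have bE : slope * b = `|h 0| by rewrite mulrC divfK// gt_eqF.
have hb : 0 <= h b.
  have /andP[+ _] := defect_incr b0; rewrite subr0 bE.
  have := ler_norm (- h 0); rewrite normrN; lra.
have hNb : h (- b) <= 0.
  have nb0 : - b <= 0 by rewrite oppr_le0.
  have /andP[+ _] := defect_incr nb0; rewrite sub0r opprK bE.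
  have := ler_norm (h 0); lra.
have [w _ hw] : exists2 w, w \in `[- b, b] & h w = 0.
  apply: IVT.
  - by rewrite -subr_ge0 opprK addr_ge0.
  - exact/continuous_subspaceT/continuous_defect.
  - by rewrite ge_min hNb le_max hb orbT.
have wE : w = c * m_nu w by apply/eqP; rewrite -subr_eq0; apply/eqP.
have hinj w' : h w' = 0 -> w' = w.
  move=> hw'; have aux x y : x <= y -> h x = 0 -> h y = 0 -> x = y.
    move=> xy hx hy; apply/eqP; rewrite eq_le xy/= -subr_le0.
    have /andP[+ _] := defect_incr xy; rewrite hx hy subrr.
    by rewrite pmulr_rle0.
  by have [|/ltW] := leP w' w => le; [exact: aux|apply/esym; exact: aux].
have -> : omega_kappa kappa = w.
  apply: the_unique_eq => // w' wE'; apply: hinj.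
  by rewrite /defect {1}wE' subrr.
split=> //; rewrite ltNge; apply/negP => r2w.
have /andP[+ _] := defect_incr r2w; rewrite hw /defect m_nu_sqrt2 mulr0 subr0 sub0r.
move=> /le_trans /(_ (_ : - r2 <= 0)); rewrite oppr_le0 sqrtr_ge0 => /(_ isT).
rewrite pmulr_rle0// subr_le0 => wr2.
have wr : w = r2 by apply/eqP; rewrite eq_le wr2.
move: hw; rewrite wr /defect m_nu_sqrt2 mulr0 subr0.
by apply/eqP; rewrite gt_eqF// sqrt2_gt0.
Qed.

Lemma E_kappa_sqrt2 : E r2 = 0.
Proof. by rewrite /E_kappa m_nu_sqrt2 s_nu_sqrt2 expr0n/= mulr0 addr0. Qed.

Lemma E_kappa_decr w w' : w < w' -> w' < r2 -> E w' < E w.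
Proof.
move=> ww' w'r; have /andP[+ _] := E_kappa_incr (ltW ww').
have /andP[+ _] := defect_incr (ltW ww').
have sd : 0 < slope * (w' - w) by rewrite mulr_gt0 ?subr_gt0// defect_slope_gt0.
move=> /(lt_le_trans sd) h0; rewrite -subr_gt0; apply: lt_le_trans.
by rewrite !mulr_gt0// m_nu_gt0.
Qed.

Lemma omega_alpha_kappa_def alpha : 0 < alpha ->
  omega_alpha_kappa alpha kappa < r2 /\ E (omega_alpha_kappa alpha kappa) = alpha.
Proof.
move=> a0; have sl := defect_slope_gt0.
(* [E_kappa_incr] gives no growth to the left of sqrt 2, where m vanishes, but
   linear growth to the left of any smaller point. *)
pose w1 := r2 - 1; have w1r : w1 < r2 by rewrite gtrBl.
have m1 := m_nu_gt0 w1r.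
have E1 : 0 <= E w1.
  have /andP[+ _] := E_kappa_incr (ltW w1r).
  by rewrite m_nu_sqrt2 mulr0 mul0r E_kappa_sqrt2 subr0.
pose w0 := w1 - alpha / (2 * m_nu w1 * slope).
have w01 : w0 <= w1 by rewrite gerBl divr_ge0 ?ltW// ?mulr_gt0.
have E0 : alpha <= E w0.
  have /andP[+ _] := E_kappa_incr w01; have /andP[+ _] := defect_incr w01.
  have -> : w1 - w0 = alpha / (2 * m_nu w1 * slope) by rewrite /w0; ring.
  move=> hh; have m2 : 0 <= 2 * m_nu w1 by rewrite mulr_ge0// ltW.
  have := ler_wpM2l m2 hh.
  have -> : 2 * m_nu w1 * (slope * (alpha / (2 * m_nu w1 * slope))) = alpha.
    by rewrite mulrA mulrC divfK// gt_eqF// !mulr_gt0.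
  lra.
have w0r : w0 <= r2 by rewrite (le_trans w01)// ltW.
have [w wI Ew] : exists2 w, w \in `[w0, r2] & E w = alpha.
  apply: IVT => //.
  - exact/continuous_subspaceT/continuous_E_kappa.
  - by rewrite E_kappa_sqrt2 ge_min (ltW a0) orbT le_max E0.
have wr : w < r2.
  move: wI; rewrite in_itv/= => /andP[_]; rewrite le_eqVlt => /predU1P[wr|//].
  by move: a0; rewrite -Ew wr E_kappa_sqrt2 !ltxx.
have -> : omega_alpha_kappa alpha kappa = w.
  apply: the_unique_eq => // w' [w'r Ew'].
  have [ww'|ww'|//] := ltgtP w' w.
  - by have := E_kappa_decr ww' wr; rewrite Ew Ew' ltxx.
  - by have := E_kappa_decr ww' w'r; rewrite Ew Ew' ltxx.
by [].
Qed.

(** Write t = alpha - alpha_star, v for [omega_alpha_kappa], w for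
    [omega_kappa], g = - defect v and u = 2 m(w) g. Then [E_kappa_incr] between
    v and w says that t - u lies between 0 and a multiple of (w - v) ^ 2, hence
    of t ^ 2; and [e_star] is u ^ 2 / (2 alpha m(w) ^ 2). *)
Lemma e_star_cubic : exists2 C, 0 < C & forall alpha, alpha_star kappa < alpha ->
  `|e_star alpha kappa - (alpha - alpha_star kappa) ^+ 2
       / (2 * alpha_star kappa * m_nu (omega_kappa kappa) ^+ 2)| <=
  C * (alpha - alpha_star kappa) ^+ 3.
Proof.
have [wE wr] := omega_kappa_def.
have m0 := m_nu_gt0 wr.
rewrite (alpha_starE kappa_gt1 wE m0).
set w := omega_kappa kappa in wE wr m0 *; set m := m_nu w in m0 *.
have hw : h w = 0 by rewrite /defect {1}wE subrr.
have A0 : 0 < E w := s_nu_form_gt0 c_gtN1 m0.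
set A := E w in A0 *.
have sl := defect_slope_gt0.
pose K := (1 + `|c|) / slope ^+ 2.
have K0 : 0 <= K by rewrite divr_ge0 ?addr_ge0// exprn_ge0// ltW.
pose K' := K / (4 * m ^+ 2).
have K'0 : 0 <= K' by rewrite divr_ge0// mulr_ge0// exprn_ge0// ltW.
exists ((1 + 2 * A * K') / (2 * A ^+ 2 * m ^+ 2)).
  rewrite divr_gt0//; last by rewrite !mulr_gt0 ?exprn_gt0.
  by rewrite ltr_pwDl// mulr_ge0// mulr_ge0// ltW.
move=> alpha Aalpha; have al0 : 0 < alpha by exact: lt_trans Aalpha.
have [] := omega_alpha_kappa_def al0.
rewrite /e_star; set v := omega_alpha_kappa alpha kappa => vr Ev.
have vw : v <= w.
  rewrite leNgt; apply/negP => wv; have := E_kappa_decr wv vr.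
  by rewrite Ev -/A ltNge (ltW Aalpha).
have /andP[lo up] := E_kappa_incr vw; have /andP[hlo _] := defect_incr vw.
rewrite Ev -/A -/m hw sub0r in lo up; rewrite hw sub0r in hlo.
have -> : c * m_nu v - v = - h v by rewrite /defect opprB.
set g := - h v in lo up hlo *; set t := alpha - A in lo up *.
have t0 : 0 < t by rewrite subr_gt0.
have d0 : 0 <= w - v by rewrite subr_ge0.
have g0 : 0 <= g by apply: le_trans hlo; rewrite mulr_ge0// ltW.
rewrite ger0_pospart//.
pose u := 2 * m * g.
have u0 : 0 <= u by rewrite !mulr_ge0// ltW.
have dg : (1 + `|c|) * (w - v) ^+ 2 <= K' * u ^+ 2.
  have -> : K' * u ^+ 2 = (1 + `|c|) * (g / slope) ^+ 2.
    by rewrite /K' /K /u; field; rewrite !gt_eqF.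
  rewrite ler_wpM2l ?addr_ge0// ler_sqr ?nnegrE ?divr_ge0 ?(ltW sl)//.
  by rewrite ler_pdivlMr// mulrC.
have ut : u <= t by exact: lo.
have uu : u ^+ 2 <= t ^+ 2 by rewrite ler_sqr ?nnegrE// ltW.
have tu : t - u <= K' * t ^+ 2.
  have := ler_wpM2l K'0 uu; rewrite -/u in up; lra.
have tu2 : t ^+ 2 - u ^+ 2 <= 2 * K' * t ^+ 3.
  rewrite subr_sqr (_ : 2 * K' * t ^+ 3 = (K' * t ^+ 2) * (2 * t)); last by ring.
  by apply: ler_pM; rewrite ?subr_ge0//; [rewrite addr_ge0// ltW|lra].
(* The t ^ 3 accounts for dividing by alpha rather than by its limit A. *)
have -> : 2 / alpha * g ^+ 2 - t ^+ 2 / (2 * A * m ^+ 2) =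
    - ((t ^+ 3 + A * (t ^+ 2 - u ^+ 2)) / (2 * A * alpha * m ^+ 2)).
  have -> : t ^+ 3 = t ^+ 2 * (alpha - A) by rewrite -/t; ring.
  by rewrite /u; field; rewrite !gt_eqF.
have N0 : 0 <= t ^+ 3 + A * (t ^+ 2 - u ^+ 2).
  by rewrite addr_ge0 ?exprn_ge0 ?mulr_ge0 ?subr_ge0// ltW.
have D0 : 0 < 2 * A * alpha * m ^+ 2 by rewrite !mulr_gt0 ?exprn_gt0.
rewrite normrN ger0_norm ?divr_ge0 ?(ltW D0)//.
have -> : (1 + 2 * A * K') / (2 * A ^+ 2 * m ^+ 2) * t ^+ 3 =
    (t ^+ 3 + A * (2 * K' * t ^+ 3)) / (2 * A * A * m ^+ 2).
  by field; rewrite !gt_eqF.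
apply: ler_pM => //.
- by rewrite invr_ge0 ltW.
- by rewrite lerD2l ler_pM2l.
- rewrite lef_pV2 ?posrE// ?mulr_gt0 ?exprn_gt0//.
  rewrite ler_pM2r ?exprn_gt0// ler_pM2l ?mulr_gt0//; exact: ltW.
Qed.

End increments.

Theorem lemma5p12 (R : realType) (kappa : R) (hkappa : 1 < kappa) :
  (fun alpha : R => e_star alpha kappa : R^o)
  = (fun alpha : R => (alpha - alpha_star kappa) ^+ 2
       / (2 * alpha_star kappa * m_nu (omega_kappa kappa) ^+ 2))
    +o_ ((alpha_star kappa)^'+)
    (fun alpha : R => (alpha - alpha_star kappa) ^+ 2 : R^o).
Proof.
have [C C0 HC] := @e_star_cubic R kappa hkappa.
apply/eqaddoP => e e0.
near=> a.
have aA : alpha_star kappa < a by near: a; exact: nbhs_right_gt.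
have ae : a < alpha_star kappa + e / C.
  by near: a; apply: nbhs_right_lt; rewrite ltrDl divr_gt0.
apply: (le_trans (HC _ aA)).
rewrite [X in _ <= _ * X]ger0_norm ?sqr_ge0// exprS mulrA ler_wpM2r ?sqr_ge0//.
by rewrite mulrC -ler_pdivlMr// lerBlDl ltW.
Unshelve. all: by end_near. Qed.
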